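(* Let $k_1>k_2\ge 0$ and $n\ge 2$ be integers and put $I=[-k_2,k_1]^{*}$. There exists a lattice tiling of $\mathbb{Z}^n$ by $\mathcal{B}(n,2,k_1,k_2)$ if and only if there exist a finite abelian group $G$ (written multiplicatively, identity $e$) of order $1+n(k_1+k_2)+\binom{n}{2}(k_1+k_2)^2$ and a subset $T=\{t_1,\dots,t_n\}\subset G$ with $|T|=n$ satisfying either of the following two conditions, which are equivalent: (1) In the integral group ring $\mathbb{Z}[G]$, \[G=e+\sum_{i=1}^{n}\sum_{j\in I}t_i^{j}+\sum_{1\le i<j\le n}\Big(\sum_{k\in I}t_i^{k}\Big)\Big(\sum_{l\in I}t_j^{l}\Big),\] where $G$ on the left denotes the sum of all elements of $G$. (2) $G$ is the disjoint union \[G=\{e\}\cup\bigcup_{i\in I}T^{(i)}\cup\bigcup_{i,j\in I,\ i\le j}S(i,j),\] i.e. all the sets on the right-hand side are pairwise disjoint and their union is $G$.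
   Context: $\mathcal{B}(n,t,k_1,k_2)=\{\mathbf{a}\in\mathbb{Z}^n : a_i\in[-k_2,k_1]\ \forall i,\ \mathrm{wt}(\mathbf{a})\le t\}$ with $\mathrm{wt}$ the Hamming weight; a lattice tiling of $\mathbb{Z}^n$ by $\mathcal{B}$ is a lattice $C\subset\mathbb{Z}^n$ whose translates $\mathcal{B}+c$, $c\in C$, partition $\mathbb{Z}^n$. For integers $a<b$, $[a,b]^{*}=\{i\ne 0: a\le i\le b\}$. For $T\subset G$ and an integer $i$, $T^{(i)}=\{t^i: t\in T\}$, and for integers $i,j$, $S(i,j)=\{g^ih^j : g,h\in T,\ g\ne h\}$. *)

(* Defs.v *)
From HB Require Import structures.
From mathcomp Require Import all_boot all_order all_algebra all_fingroup.

Set Implicit Arguments.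
Unset Strict Implicit.
Unset Printing Implicit Defensive.

Import Order.TTheory GRing.Theory Num.Theory.

Local Open Scope ring_scope.

Section Tilings.

Variable n : nat.
Implicit Types (a c x : 'rV[int]_n) (B C : {pred 'rV[int]_n}).

Definition wt a : nat := #|[set i | a 0 i != 0]|.

Definition error_ball (t k1 k2 : nat) : {pred 'rV[int]_n} :=
  [pred a : 'rV[int]_n | [forall i, - k2%:Z <= a 0 i <= k1%:Z] && (wt a <= t)%N].

Definition translate B c : {pred 'rV[int]_n} := [pred x : 'rV[int]_n | x - c \in B].

(* A lattice in Z^n is an additive subgroup of Z^n.  Full rank is not asked
   for separately: a subgroup whose translates of a finite set cover Z^n
   has finite index. *)
Definition lattice_tiling B C : Prop :=
  [/\ zmod_closed C,
      forall x, exists2 c, c \in C & x \in translate B c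
    & {in C &, forall c d, c != d ->
        forall x, ~~ ((x \in translate B c) && (x \in translate B d))}].

End Tilings.

Definition istar (a b : int) : seq int :=
  [seq i <- [seq a + k%:Z | k <- iota 0 `|b - a|%N.+1] |
     (i != 0) && (a <= i <= b)].

Lemma mem_istar (a b i : int) :
  (i \in istar a b) = (i != 0) && (a <= i <= b).
Proof.
rewrite mem_filter; apply: andb_idr => /andP[_ /andP[ai ib]].
apply/mapP; exists `|i - a|%N; last first.
  by rewrite gez0_abs ?subr_ge0 // subrKC.
rewrite mem_iota add0n ltnS leq0n -lez_nat !gez0_abs ?subr_ge0 ?lerD2r //.
exact: le_trans ai ib.
Qed.

Lemma istar_uniq (a b : int) : uniq (istar a b).
Proof.
by rewrite filter_uniq // map_inj_uniq ?iota_uniq // => k l /addrI [].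
Qed.

Definition expgz (gT : finGroupType) (x : gT) (i : int) : gT :=
  match i with
  | Posz m => (x ^+ m)%g
  | Negz m => (x ^- m.+1)%g
  end.

(* The integral group ring Z[gT].  It is a new constant rather than
   {ffun gT -> int} itself because the library equips the latter with the
   pointwise product; here the product is convolution. *)
Definition intgring (gT : finGroupType) : Type := {ffun gT -> int}.

Section IntGroupRing.

Variable gT : finGroupType.
Implicit Types (u v w : intgring gT) (x y g : gT).

HB.instance Definition _ := GRing.Zmodule.on (intgring gT).

Definition grelt g : intgring gT := [ffun x => (x == g)%:R : int].

Definition gr_mul u v : intgring gT :=
  [ffun x => \sum_y u y * v (y^-1 * x)%g].

Fact gr_mulA : associative gr_mul.
Proof.
move=> u v w; apply/ffunP=> x; rewrite !ffunE.
transitivity (\sum_y \sum_z u y * (v z * w (z^-1 * (y^-1 * x))%g)).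
  by apply: eq_bigr => y _; rewrite ffunE mulr_sumr.
transitivity (\sum_y \sum_z u y * (v (y^-1 * z)%g * w (z^-1 * x)%g)).
  apply: eq_bigr => y _; rewrite (reindex_inj (mulgI y^-1%g)) /=.
  by apply: eq_bigr => z _; rewrite invMg invgK -mulgA mulKVg.
rewrite exchange_big; apply: eq_bigr => z _ /=; rewrite ffunE mulr_suml.
by apply: eq_bigr => y _; rewrite mulrA.
Qed.

Fact gr_mul1r : left_id (grelt 1) gr_mul.
Proof.
move=> u; apply/ffunP=> x; rewrite ffunE (bigD1 1%g) //= big1 => [|y /negPf y1].
  by rewrite ffunE eqxx mul1r invg1 mul1g addr0.
by rewrite ffunE y1 mul0r.
Qed.

Fact gr_mulr1 : right_id (grelt 1) gr_mul.
Proof.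
move=> u; apply/ffunP=> x; rewrite ffunE (bigD1 x) //= big1 => [|y yx].
  by rewrite ffunE mulVg eqxx mulr1 addr0.
by rewrite ffunE -eq_mulVg1 (negPf yx) mulr0.
Qed.

Fact gr_mulDl : left_distributive gr_mul +%R.
Proof.
move=> u v w; apply/ffunP=> x; rewrite !ffunE -big_split /=.
by apply: eq_bigr => y _; rewrite ffunE mulrDl.
Qed.

Fact gr_mulDr : right_distributive gr_mul +%R.
Proof.
move=> u v w; apply/ffunP=> x; rewrite !ffunE -big_split /=.
by apply: eq_bigr => y _; rewrite ffunE mulrDr.
Qed.

HB.instance Definition _ := GRing.Zmodule_isPzRing.Build (intgring gT)
  gr_mulA gr_mul1r gr_mulr1 gr_mulDl gr_mulDr.

Lemma greltM g h : grelt g * grelt h = grelt (g * h)%g.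
Proof.
apply/ffunP=> x; rewrite !ffunE (bigD1 g) //= big1 => [|y /negPf yg].
  by rewrite !ffunE eqxx mul1r addr0 -(inj_eq (mulgI g)) mulKVg.
by rewrite ffunE yg mul0r.
Qed.

End IntGroupRing.

Section Conditions.

Variables (gT : finGroupType) (I : seq int).

Definition group_ring_condition (n : nat) (t : 'I_n -> gT) : Prop :=
  \sum_g grelt g =
    grelt (1%g : gT)
    + \sum_(i < n) \sum_(j <- I) grelt (expgz (t i) j)
    + \sum_(i < n) \sum_(j < n | (i < j)%N)
        (\sum_(k <- I) grelt (expgz (t i) k))
        * (\sum_(l <- I) grelt (expgz (t j) l)).

Definition Tpow (T : {set gT}) (i : int) : {set gT} :=
  [set expgz x i | x in T].

Definition Sprod (T : {set gT}) (i j : int) : {set gT} :=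
  [set (expgz g i * expgz h j)%g | g in T, h in T & g != h].

(* The family is indexed: two members with different indices must be disjoint
   even if they happen to be described by the same set. *)
Definition partition_blocks (T : {set gT}) : seq {set gT} :=
  [set 1%g] :: [seq Tpow T i | i <- I]
    ++ [seq Sprod T i j | i <- I, j <- [seq j <- I | i <= j]].

Definition partition_condition (T : {set gT}) : Prop :=
  pairwise (fun A B : {set gT} => [disjoint A & B]) (partition_blocks T)
  /\ \bigcup_(A <- partition_blocks T) A = [set: gT].

End Conditions.

(* Main.v *)
(* Let phi : Z^n -> G send a to the product of the t_i^{a_i}.  Expanding
   the right-hand side of (1) gives the sum of phi(a) over the error vectors a,
   so (1) says that phi is a bijection from the ball onto G; as |G| is the
   number of error vectors, injectivity or surjectivity on the ball suffices.
   The blocks in (2) are the images under phi of the error vectors with a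
   given multiset of nonzero entries, so (2) also says that phi is bijective
   on the ball.  A tiling lattice C yields the group Z^n / C with t_i the class
   of the i-th basis vector, and conversely the kernel of phi is a tiling
   lattice. *)

Require Import Defs.
From HB Require Import structures.
From mathcomp Require Import all_boot all_order all_algebra all_fingroup.
From mathcomp Require Import zify.

Set Implicit Arguments.
Unset Strict Implicit.
Unset Printing Implicit Defensive.

Import Order.TTheory GRing.Theory Num.Theory.
Local Open Scope ring_scope.

(** * Enumeration of the error vectors of weight at most 2 *)

Section BallEnumeration.

Variable n : nat.
Implicit Types (i j : 'I_n) (a : 'rV[int]_n) (I : seq int).

Definition spike i (k : int) : 'rV[int]_n := k *: delta_mx 0 i.

Lemma spikeE i k j : spike i k 0 j = if j == i then k else 0.
Proof. by rewrite !mxE eqxx /=; case: eqP; rewrite ?mulr1 ?mulr0. Qed.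

Lemma spike2E i j k l x : i != j ->
  (spike i k + spike j l) 0 x = if x == i then k else if x == j then l else 0.
Proof.
move=> ij; rewrite mxE !spikeE.
case: (eqVneq x i) => [->|_]; last by rewrite add0r.
by rewrite (negPf ij) addr0.
Qed.

(** The order follows the three terms of (1), with pairs of positions restricted to [i < j]. A list
    rather than a set keeps multiplicities, so injectivity on the ball becomes [uniq] of an image
    list. *)
Definition ball_seq I : seq 'rV[int]_n :=
  0 :: [seq spike i k | i <- enum 'I_n, k <- I]
    ++ [seq spike p.1 q.1 + spike p.2 q.2
         | p <- [seq p : 'I_n * 'I_n <- enum {: 'I_n * 'I_n} | (p.1 < p.2)%N],
           q <- [seq (k, l) | k <- I, l <- I]].

(** The target is a general monoid so that the formula serves both counting in [nat] and the
    expansion in the group ring. *)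
Lemma big_ball_seq (V : nmodType) I (F : 'rV[int]_n -> V) :
  \sum_(a <- ball_seq I) F a =
  F 0 + \sum_(i < n) \sum_(k <- I) F (spike i k)
      + \sum_(i < n) \sum_(j < n | (i < j)%N) \sum_(k <- I) \sum_(l <- I)
          F (spike i k + spike j l).
Proof.
rewrite /ball_seq big_cons big_cat /= addrA; congr (_ + _ + _).
  by rewrite big_allpairs_dep big_enum.
rewrite big_allpairs_dep big_filter big_enum_cond pair_big_dep /=.
by apply: eq_bigr => p _; rewrite big_allpairs_dep.
Qed.

Lemma size_ball_seq I :
  size (ball_seq I) = (1 + n * size I + 'C(n, 2) * size I ^ 2)%N.
Proof.
have sum_const (T : Type) (r : seq T) c : (\sum_(x <- r) c)%N = (size r * c)%N.
  by rewrite big_const_seq count_predT iter_addn_0 mulnC.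
have -> : size (ball_seq I) =
    (1 + \sum_(i < n) \sum_(k <- I) 1
       + \sum_(i < n) \sum_(j < n | i < j) \sum_(k <- I) \sum_(l <- I) 1)%N.
  by rewrite -sum1_size; exact: (big_ball_seq (V := nat)).
congr (_ + _ + _)%N; first by rewrite sum_nat_const card_ord sum1_size.
(* Each [j] has exactly [j] indices below it, and these numbers add up to ['C(n, 2)]. *)
rewrite sum1_size sum_const (exchange_big_dep xpredT) //=.
rewrite -bin2_sum big_mkord big_distrl /=; apply: eq_bigr => j _.
by rewrite (big_ord_narrow (ltnW (ltn_ord j))) sum_nat_const card_ord mulnn.
Qed.

(** A normal form, ordered by position, from which the indices and coefficients of a sum of spikes
    can be read off. *)
Definition supp a : seq ('I_n * int) :=
  [seq (i, a 0 i) | i <- enum 'I_n & a 0 i != 0].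

Lemma supp0 : supp 0 = [::].
Proof.
rewrite /supp (eq_filter (a2 := pred0)) ?filter_pred0 // => i.
by rewrite mxE eqxx.
Qed.

Lemma supp_spike i k : k != 0 -> supp (spike i k) = [:: (i, k)].
Proof.
move=> k0; rewrite /supp (_ : [seq x <- _ | _] = [:: i]) /= ?spikeE ?eqxx //.
rewrite -(@filter_pred1_uniq _ (enum 'I_n)) ?enum_uniq ?mem_enum //.
by apply: eq_filter => j; rewrite spikeE /=; case: (j == i); rewrite ?eqxx.
Qed.

Lemma supp_spike2 i j k l : (i < j)%N -> k != 0 -> l != 0 ->
  supp (spike i k + spike j l) = [:: (i, k); (j, l)].
Proof.
move=> ij k0 l0.
have nij : i != j by rewrite -val_eqE /= neq_ltn ij.
rewrite /supp (_ : [seq x <- _ | _] = [:: i; j]) /=; first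
  by rewrite ?spike2E ?eqxx // 1?eq_sym ?(negPf nij).
(* Two strictly increasing lists with the same members are equal. *)
apply: (irr_sorted_eq (leT := relpre val ltn)) => [x y z|x|||x].
- exact: ltn_trans.
- exact: ltnn.
- apply: sorted_filter => [x y z|]; first exact: ltn_trans.
  by rewrite -sorted_map val_enum_ord iota_ltn_sorted.
- by rewrite /= ij.
rewrite mem_filter mem_enum andbT spike2E // !inE.
by case: (x == i); case: (x == j); rewrite /= ?k0 ?l0 ?eqxx.
Qed.

(** The length of [supp] separates the three parts of the list. Within a part [supp] returns the
    parameters, because all coefficients are nonzero. *)
Lemma ball_seq_uniq I : uniq I -> 0 \notin I -> uniq (ball_seq I).
Proof.
move=> uI I0; have nz k : k \in I -> k != 0 by apply: contraTneq => ->.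
rewrite /ball_seq cons_uniq mem_cat negb_or cat_uniq; apply/and4P; split.
- apply/andP; split; apply/negP => /allpairsPdep.
    by case=> i [k [_ /nz k0 /(congr1 supp)]]; rewrite supp0 supp_spike.
  case=> p [q [+ /allpairsPdep[k [l [/nz k0 /nz l0 ->]]] /(congr1 supp)]].
  by rewrite mem_filter => /andP[ij _]; rewrite supp0 supp_spike2.
- apply: allpairs_uniq => //; first exact: enum_uniq.
  move=> _ _ /allpairsPdep[i [k [_ /nz k0 ->]]]
    /allpairsPdep[j [l [_ /nz l0 ->]]].
  by move/(congr1 supp); rewrite /= !supp_spike // => -[-> ->].
- apply/hasPn => _ /allpairsPdep[p [q [+ pq ->]]].
  case/allpairsPdep: pq => k [l [/nz k0 /nz l0 ->]].
  rewrite mem_filter => /andP[ij _]; apply/negP.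
  case/allpairsPdep=> i [m [_ /nz m0]].
  by move/(congr1 supp); rewrite supp_spike2 // supp_spike.
apply: allpairs_uniq; first by rewrite filter_uniq // enum_uniq.
  by apply: allpairs_uniq => // -[? ?] [? ?].
move=> _ _ /allpairsPdep[p [q [pP /allpairsPdep[k [l [/nz k0 /nz l0 ->]]] ->]]]
  /allpairsPdep[p' [q' [p'P /allpairsPdep[k' [l' [/nz k0' /nz l0' ->]]] ->]]].
move: pP p'P; rewrite !mem_filter => /andP[ij _] /andP[ij' _] /(congr1 supp).
rewrite /= !supp_spike2 //; case: p p' {ij ij'} => [? ?] [? ?] /=.
by case=> -> -> -> ->.
Qed.

(** Two positions are only asked to differ; [ball_seqP] restores the order by commutativity of
    addition. *)
Variant ball_spec I : 'rV[int]_n -> Prop :=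
  | BallSpec0 : ball_spec I 0
  | BallSpec1 i k of k \in I : ball_spec I (spike i k)
  | BallSpec2 i j k l of i != j & k \in I & l \in I :
      ball_spec I (spike i k + spike j l).

Lemma ball_seqP I a : reflect (ball_spec I a) (a \in ball_seq I).
Proof.
apply: (iffP idP) => [|[|i k kI|i j k l ij kI lI]].
- rewrite inE mem_cat => /or3P[/eqP->|/allpairsP[[i k] [_ kI ->]]|].
  + exact: BallSpec0.
  + exact: BallSpec1.
  move=> /allpairsPdep[[i j] [q [+ /allpairsP[[k l] [kI lI ->]] ->]]].
  rewrite mem_filter => /andP[ij _]; apply: BallSpec2 => //.
  by rewrite -val_eqE /= neq_ltn ij.
- exact: mem_head.
- by rewrite inE mem_cat allpairs_f ?mem_enum // orbT.
wlog lt_ij : i j k l ij kI lI / (i < j)%N => [IH|].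
  case: (ltngtP i j) => [||/ord_inj eq_ij]; first exact: IH.
    by rewrite addrC; apply: IH; rewrite // eq_sym.
  by rewrite eq_ij eqxx in ij.
rewrite inE mem_cat; apply/or3P/Or33/allpairsPdep; exists (i, j), (k, l).
by split=> //; [rewrite mem_filter lt_ij mem_enum | apply: allpairs_f].
Qed.

(* An invariant of error vectors that recovers the index of the block of
   [partition_blocks] containing the image of the vector. *)
Definition profile a : seq int := sort <=%R [seq u.2 | u <- supp a].

Lemma profile_spike2 i j k l : i != j -> k != 0 -> l != 0 ->
  profile (spike i k + spike j l) = if k <= l then [:: k; l] else [:: l; k].
Proof.
move=> ij k0 l0; have sort2 (u v : int) : sort <=%R [:: u; v] =
  if u <= v then [:: u; v] else [:: v; u].
  by rewrite /sort /=; case: (u <= v).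
case: (ltngtP i j) => [lt|gt|/ord_inj e].
- by rewrite /profile supp_spike2 // sort2.
- rewrite [spike i k + _]addrC /profile supp_spike2 // sort2.
  by case: (ltgtP l k) => // ->.
- by rewrite e eqxx in ij.
Qed.

Lemma mem_ball_seq k1 k2 a :
  (a \in ball_seq (istar (- k2%:Z) k1%:Z)) = (a \in @error_ball n 2 k1 k2).
Proof.
(* Entries outside the support must satisfy the bounds as well. *)
have range0 : - k2%:Z <= 0 <= k1%:Z by lia.
apply/ball_seqP/idP; rewrite inE.
  case=> [|i k|i j k l ij]; rewrite ?mem_istar.
  - apply/andP; split; first by apply/forallP => i; rewrite mxE.
    rewrite /wt (_ : [set _ | _] = set0) ?cards0 //.
    by apply/setP => i; rewrite !inE mxE eqxx.
  - case/andP=> _ kP; apply/andP; split.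
      by apply/forallP => x; rewrite spikeE; case: ifP.
    apply: leq_trans (subset_leq_card (_ : _ \subset [set i])) _.
      by apply/subsetP => x; rewrite !inE spikeE; case: (x == i); rewrite ?eqxx.
    by rewrite cards1.
  case/andP=> _ kP /andP[_ lP]; apply/andP; split.
    by apply/forallP => x; rewrite spike2E //; do 2!case: ifP => // _.
  apply: leq_trans (subset_leq_card (_ : _ \subset [set i; j])) _.
    apply/subsetP => x; rewrite !inE spike2E //.
    by case: (x == i); case: (x == j); rewrite ?eqxx.
  by rewrite cards2 ij.
case/andP=> /forallP aP; rewrite /wt.
have aI x : a 0 x != 0 -> a 0 x \in istar (- k2%:Z) k1.
  by rewrite mem_istar aP => ->.
rewrite leq_eqVlt ltnS leq_eqVlt ltnS leqn0 cards_eq0.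
case/or3P=> [/cards2P[i [j [ij E]]]|/cards1P[i E]|/eqP E].
- have aE x : (a 0 x != 0) = (x == i) || (x == j).
    by have /setP/(_ x) := E; rewrite !inE.
  rewrite (_ : a = spike i (a 0 i) + spike j (a 0 j)).
    by apply: BallSpec2 => //; apply: aI; rewrite aE eqxx ?orbT.
  apply/rowP => x; rewrite spike2E //; case: eqVneq => [-> //|xi].
  case: eqVneq => [-> //|xj]; apply/eqP/negPn.
  by rewrite aE (negPf xi) (negPf xj).
- have aE x : (a 0 x != 0) = (x == i) by have /setP/(_ x) := E; rewrite !inE.
  rewrite (_ : a = spike i (a 0 i)); first by apply/BallSpec1/aI; rewrite aE.
  apply/rowP => x; rewrite spikeE; case: eqVneq => [-> //|xi].
  by apply/eqP/negPn; rewrite aE (negPf xi).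
rewrite (_ : a = 0); first exact: BallSpec0.
apply/rowP => x; rewrite mxE; apply/eqP/negPn.
by have /setP/(_ x) := E; rewrite !inE => ->.
Qed.

End BallEnumeration.

(** * The index set and integer powers *)

Lemma istar0 (x y : int) : 0 \notin istar x y.
Proof. by rewrite mem_istar eqxx. Qed.

Lemma size_istar (k1 k2 : nat) : size (istar (- k2%:Z) k1%:Z) = (k1 + k2)%N.
Proof.
pose s := [seq k.+1%:Z | k <- iota 0 k1] ++ [seq - k.+1%:Z | k <- iota 0 k2].
have <- : size s = (k1 + k2)%N by rewrite size_cat !size_map !size_iota.
apply/perm_size/uniq_perm; first exact: istar_uniq.
  rewrite cat_uniq !map_inj_uniq ?iota_uniq ?andbT /=; last first.
  - by move=> k l [].
  - by move=> k l /oppr_inj[].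
  by apply/hasPn => _ /mapP[k _ ->]; apply/mapP => -[].
move=> x; rewrite mem_istar mem_cat; case: x => m.
  apply/idP/orP => [/and3P[m0 _ mk]|[/mapP[k]|/mapP[k _] //]].
    by left; apply/mapP; exists m.-1; [rewrite mem_iota; lia | lia].
  by rewrite mem_iota => ? ->; lia.
rewrite NegzE; apply/idP/orP => [/and3P[_ km _]|[/mapP[k _] //|/mapP[k]]].
  by right; apply/mapP; exists m; [rewrite mem_iota; lia | lia].
by rewrite mem_iota => ? ->; lia.
Qed.

Lemma uniq_map_inj_in (T1 T2 : eqType) (f : T1 -> T2) (s : seq T1) :
  uniq (map f s) -> {in s &, injective f}.
Proof.
elim: s => //= z s IH /andP[zs /IH{}IH] x y; rewrite !inE.
case/predU1P=> [->|xs] /predU1P[->|ys] // E; last exact: IH.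
  by rewrite E map_f in zs.
by rewrite -E map_f in zs.
Qed.

Lemma expgzS (gT : finGroupType) (x : gT) i :
  expgz x (i + 1) = (expgz x i * x)%g.
Proof.
(* The exponent -1 stands apart: adding 1 moves it to the nonnegative constructor. *)
case: i => [m|[|m]]; first by rewrite -PoszD addn1 /= expgSr.
  by rewrite /= mulVg.
rewrite (_ : Negz m.+1 + 1 = Negz m) /=; last by lia.
by rewrite -!expgVn [in RHS]expgSr mulgKV.
Qed.

Lemma expgzD (gT : finGroupType) (x : gT) i j :
  expgz x (i + j) = (expgz x i * expgz x j)%g.
Proof.
elim/int_ind: j => [|m IH|m IH]; first by rewrite addr0 mulg1.
  by rewrite -addn1 PoszD addrA !expgzS IH mulgA.
have P y : expgz x (y - 1) = (expgz x y * x^-1)%g.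
  by rewrite -{2}(subrK 1 y) expgzS mulgK.
by rewrite -addn1 PoszD opprD addrA !P IH mulgA.
Qed.

(** * The map phi and the equivalence of (1) and (2) *)

Section Evaluation.

Variables (n : nat) (gT : finGroupType) (t : 'I_n -> gT).
Hypothesis abG : abelian [set: gT].

Let mulCg (x y : gT) : (x * y = y * x)%g.
Proof. by have /centsP := abG; apply; rewrite ?in_setT. Qed.

(** This is the map phi. *)
Definition monom (a : 'rV[int]_n) : gT := (\prod_(i < n) expgz (t i) (a 0 i))%g.

Lemma monomD : {morph monom : a b / a + b >-> (a * b)%g}.
Proof.
move=> a b; rewrite /monom.
apply: (big_rec3 (fun x y z => z = (x * y)%g)) => [|i x y z _ ->].
  by rewrite mulg1.
by rewrite mxE expgzD -!mulgA; congr (_ * _)%g; rewrite !mulgA (mulCg x).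
Qed.

Lemma monom0 : monom 0 = 1%g.
Proof. by rewrite /monom big1 // => i _; rewrite mxE. Qed.

Lemma monomB a b : monom (a - b) = (monom a * (monom b)^-1)%g.
Proof. by apply: (canRL (mulgK _)); rewrite -monomD subrK. Qed.

Lemma monom_spike i k : monom (spike i k) = expgz (t i) k.
Proof.
rewrite /monom -[RHS](big_pred1_eq mulg i (fun j => expgz (t j) k)).
rewrite [RHS]big_mkcond; apply: eq_bigr => j _ /=.
by rewrite spikeE; case: (j == i).
Qed.

Lemma monom_spike2 i j k l :
  monom (spike i k + spike j l) = (expgz (t i) k * expgz (t j) l)%g.
Proof. by rewrite monomD !monom_spike. Qed.

Lemma group_ring_conditionE I :
  group_ring_condition I t <->
  \sum_(g <- enum gT) grelt g = \sum_(g <- map monom (ball_seq n I)) grelt g.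
Proof.
rewrite big_enum big_map big_ball_seq /group_ring_condition monom0.
set A := grelt 1 + _ + _; set B := grelt 1 + _ + _.
suff -> : A = B by [].
congr (_ + _ + _).
  by apply: eq_bigr => i _; under [RHS]eq_bigr do rewrite monom_spike.
apply: eq_bigr => i _; apply: eq_bigr => j _; rewrite mulr_suml.
apply: eq_bigr => k _; rewrite mulr_sumr; apply: eq_bigr => l _.
by rewrite greltM monom_spike2.
Qed.

Lemma grelt_sumE (s : seq gT) x :
  (\sum_(g <- s) grelt g) x = (count_mem x s)%:R.
Proof.
elim: s => [|g s IH]; first by rewrite big_nil ffunE.
by rewrite big_cons ffunE IH ffunE /= natrD eq_sym.
Qed.

(** The coefficient at [x] is the multiplicity of [x] in the list, and an integer coefficient
    determines that natural number. *)
Lemma grelt_sum_perm (s1 s2 : seq gT) :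
  \sum_(g <- s1) grelt g = \sum_(g <- s2) grelt g <-> perm_eq s1 s2.
Proof.
split=> [/ffunP E|E]; last by rewrite (perm_big _ E).
apply/allP => x _ /=.
by have /eqP := E x; rewrite !grelt_sumE eqr_nat.
Qed.

Section Counting.

Variable I : seq int.
Hypotheses (I0 : 0 \notin I) (cardG : #|gT| = size (ball_seq n I)).

(** The image list has as many entries as [gT] has elements, so without repetitions it exhausts the
    group. *)
Lemma group_ring_condition_uniq :
  group_ring_condition I t <-> uniq (map monom (ball_seq n I)).
Proof.
rewrite group_ring_conditionE grelt_sum_perm; split=> [/perm_uniq <-|U].
  exact: enum_uniq.
have le_size : (size (enum gT) <= size (map monom (ball_seq n I)))%N.
  by rewrite size_map -cardG cardE.
have sub_enum : {subset map monom (ball_seq n I) <= enum gT}.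
  by move=> x _; rewrite mem_enum.
have [_ E] := uniq_min_size U sub_enum le_size.
by apply: uniq_perm; rewrite ?enum_uniq // => x; rewrite E.
Qed.

(** By the same count, an image list that covers the group has no repetitions. *)
Lemma group_ring_condition_cover :
  group_ring_condition I t <->
  forall x, exists2 a, a \in ball_seq n I & monom a = x.
Proof.
split=> [/group_ring_conditionE/grelt_sum_perm/perm_mem E x|cov].
  by have := mem_enum gT x; rewrite E => /mapP[a aB ->]; exists a.
apply/group_ring_condition_uniq; apply: leq_size_uniq (enum_uniq gT) _ _.
  by move=> x _; have [a aB <-] := cov x; apply: map_f.
by rewrite size_map -cardG cardE.
Qed.

(** Multisets of at most two nonzero entries, written as nondecreasing lists. They label the blocks
    of (2), so that equal sets with different labels stay distinct. *)
Definition keys : seq (seq int) :=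
  [::] :: [seq [:: i] | i <- I]
    ++ [seq [:: i; j] | i <- I, j <- [seq j <- I | i <= j]].

Definition block (T : {set gT}) (c : seq int) : {set gT} :=
  match c with
  | [::] => [set 1%g]
  | [:: i] => Tpow T i
  | i :: j :: _ => Sprod T i j
  end.

Lemma partition_blocksE T : partition_blocks I T = map (block T) keys.
Proof. by rewrite /keys /= map_cat -map_comp map_allpairs. Qed.

Lemma keys_uniq : uniq I -> uniq keys.
Proof.
move=> uI; rewrite /keys cons_uniq mem_cat negb_or cat_uniq.
rewrite map_inj_uniq ?uI; last by move=> ? ? [].
rewrite -andbA; apply/and5P; split=> //.
- by apply/mapP => -[].
- by apply/negP => /allpairsPdep[? [? []]].
- by apply/hasPn => _ /allpairsPdep[i [j [_ _ ->]]]; apply/mapP => -[].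
apply: allpairs_uniq_dep => // [i _|[i j] [k l] _ _ /= [-> ->] //].
exact: filter_uniq.
Qed.

Lemma mem_bigcup_seq (s : seq {set gT}) x :
  (x \in \bigcup_(A <- s) A) = has (fun A : {set gT} => x \in A) s.
Proof. by elim: s => [|A s IH]; rewrite ?big_nil ?big_cons !inE // IH. Qed.

Let T := [set t i | i : 'I_n].
Hypothesis t_inj : injective t.

(** Together with [block_monom], this identifies each block with the image of the error vectors
    whose profile is its key. Injectivity of [t] turns [i != j] into the condition [g != h] of
    [Sprod]. *)
Lemma monom_block a : a \in ball_seq n I ->
  profile a \in keys /\ monom a \in block T (profile a).
Proof.
have nz k : k \in I -> k != 0 by apply: contraTneq => ->.
case/ball_seqP => [|i k kI|i j k l ij kI lI].
- by rewrite /profile supp0 monom0 /= !inE.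
- rewrite /profile supp_spike ?nz //= inE mem_cat monom_spike; split.
    by apply/or3P/Or32/map_f.
  by do 2!apply: imset_f.
wlog kl : i j k l ij kI lI / k <= l => [IH|].
  case: (lerP k l) => [|/ltW]; first exact: IH.
  by rewrite addrC; apply: IH; rewrite // eq_sym.
rewrite profile_spike2 ?nz // kl monom_spike2; split.
  rewrite inE mem_cat; apply/or3P/Or33/allpairsPdep; exists k, l.
  by rewrite mem_filter kl.
apply/imset2P; exists (t i) (t j); rewrite ?inE ?imset_f //=.
by rewrite (inj_eq t_inj).
Qed.

Lemma block_monom c x : c \in keys -> x \in block T c ->
  exists2 a, a \in ball_seq n I & profile a = c /\ monom a = x.
Proof.
have nz k : k \in I -> k != 0 by apply: contraTneq => ->.
rewrite inE mem_cat.
case/or3P => [/eqP->|/mapP[k kI ->]|/allpairsPdep[k [l [kI]]]] /=.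
- move/set1P->; exists 0; first exact: mem_head.
  by rewrite /profile supp0 monom0.
- case/imsetP => _ /imsetP[i _ ->] ->; exists (spike i k).
    exact/ball_seqP/BallSpec1.
  by rewrite /profile supp_spike ?nz // monom_spike.
rewrite mem_filter => /andP[kl lI ->] /imset2P[g h /imsetP[i _ ->]].
rewrite inE => /andP[/imsetP[j _ ->] ij] ->; exists (spike i k + spike j l).
  by apply/ball_seqP/BallSpec2 => //; apply: contraNneq ij => ->.
rewrite monom_spike2 profile_spike2 ?nz ?kl //.
by apply: contraNneq ij => ->.
Qed.

Lemma group_ring_partition : uniq I ->
  group_ring_condition I t <-> partition_condition I T.
Proof.
move=> uI; rewrite /partition_condition partition_blocksE; split; last first.
  (* A covering by the blocks makes phi surjective on the ball. *)
  case=> _ cov; apply/group_ring_condition_cover => x.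
  have := in_setT x; rewrite -cov mem_bigcup_seq has_map => /hasP[c ck xc].
  by have [a aB [_ <-]] := block_monom ck xc; exists a.
move=> gr; split; last first.
  apply/setP => x; rewrite in_setT mem_bigcup_seq has_map; apply/hasP.
  have [a /monom_block[pk mb] <-] := group_ring_condition_cover.1 gr x.
  by exists (profile a).
have U := group_ring_condition_uniq.1 gr.
have := keys_uniq uI; rewrite uniq_pairwise pairwise_map => neq_keys.
refine (sub_in_pairwise (P := [in keys]) _ (allss keys) neq_keys).
move=> c d ck dk /= cd.
(* A common element of two blocks is the image of one error vector from each. By injectivity these
   vectors coincide, hence so do their profiles, the two keys. *)
apply/pred0P => x /=; apply: contraNF cd => /andP[xc xd].
have [a aB [<- ax]] := block_monom ck xc.
have [b bB [<- bx]] := block_monom dk xd.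
by rewrite (uniq_map_inj_in U aB bB) // ax bx.
Qed.

End Counting.
End Evaluation.

(** * The quotient group and homomorphisms out of it *)

(* The elements of [s] represent the cosets of [C]; they are multiplied by
   adding them and reducing the sum to its representative. *)
Lemma finite_quotient (V : zmodType) (C : {pred V}) (s : seq V) :
    uniq s -> zmod_closed C ->
    (forall x, exists2 a, a \in s & x - a \in C) ->
    {in s &, forall a b, a - b \in C -> a = b} ->
  exists (gT : finGroupType) (r : V -> gT),
    [/\ {morph r : x y / x + y >-> (x * y)%g}, abelian [set: gT],
        #|gT| = size s & uniq (map r s)].
Proof.
move=> us [C0 CB] cov inj.
have CN x : x \in C -> - x \in C by move=> xC; rewrite -sub0r; apply: CB.
have CD x y : x \in C -> y \in C -> x + y \in C.
  by move=> xC yC; rewrite -[y]opprK; apply: CB; rewrite ?CN.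
have ex x : exists u : seq_sub s, x - ssval u \in C.
  by have [a aS xa] := cov x; exists (SeqSub aS).
pose r x : seq_sub s := xchoose (ex x).
have rP x : x - ssval (r x) \in C := xchooseP (ex x).
(* Since each coset has only one representative in [s], the choice made by [r] depends only on the
   coset. *)
have r_eq x y : x - y \in C -> r x = r y.
  move=> xy; apply/val_inj/inj; rewrite ?ssvalP //.
  have -> : val (r x) - val (r y) = (x - y) - (x - val (r x)) + (y - val (r y)).
    by rewrite opprB [x - y + _]addrC !subrKA.
  by apply: CD; rewrite ?rP //; apply: CB; rewrite ?rP.
have rK u : r (ssval u) = u.
  by apply/val_inj/inj; rewrite ?ssvalP // -opprB CN ?rP.
pose mul (u v : seq_sub s) : seq_sub s := r (ssval u + ssval v).
have rD x y : r (x + y) = mul (r x) (r y).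
  by apply: r_eq; rewrite opprD addrACA; apply: CD.
(* Every element is a value of [r], so the group laws are inherited from [V]. *)
have mulA : associative mul.
  by move=> u v w; rewrite -[u]rK -[v]rK -[w]rK -!rD addrA.
have mul1 : left_id (r 0) mul by move=> u; rewrite -[u]rK -rD add0r.
have mulV : left_inverse (r 0) (fun u => r (- ssval u)) mul.
  by move=> u; rewrite -{2}[u]rK -rD addNr.
pose gM := Finite_isGroup.Build (seq_sub s) mulA mul1 mulV.
pose gT : finGroupType := HB.pack (seq_sub s) gM.
exists gT, r; split.
- exact: rD.
- apply/centsP => u _ v _; rewrite /commute -[u]rK -[v]rK.
  by rewrite -!(rD : {morph (r : V -> gT) : x y / x + y >-> (x * y)%g}) addrC.
- exact: card_seq_sub.
rewrite map_inj_in_uniq // => a b aS bS E.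
by have := rK (SeqSub aS); rewrite /= E (rK (SeqSub bS)) => -[].
Qed.

Lemma morph_expgz (V : zmodType) (gT : finGroupType) (f : V -> gT) :
  {morph f : x y / x + y >-> (x * y)%g} ->
  forall x i, f (x *~ i) = expgz (f x) i.
Proof.
move=> fD x i.
have f0 : f 0 = 1%g by apply: (mulgI (f 0)); rewrite -fD addr0 mulg1.
have fX m : f (x *+ m) = (f x ^+ m)%g.
  by elim: m => [|m IH]; rewrite ?mulr0n // mulrS fD IH expgS.
case: i => m /=; first by rewrite -fX.
by apply: (mulIg (f x ^+ m.+1)%g); rewrite mulVg -fX -fD NegzE mulrNz addNr.
Qed.

(** A homomorphism on Z^n is determined by the images of the basis vectors; this recognises the
    quotient map as phi. *)
Lemma morph_monom (n : nat) (gT : finGroupType) (f : 'rV[int]_n -> gT) :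
  {morph f : x y / x + y >-> (x * y)%g} ->
  f =1 monom (fun i => f (spike i 1)).
Proof.
move=> fD a.
have f0 : f 0 = 1%g by apply: (mulgI (f 0)); rewrite -fD addr0 mulg1.
rewrite [in LHS](row_sum_delta a) (big_morph f fD f0); apply: eq_bigr => i _.
by rewrite -morph_expgz // /spike scale1r -scaler_int intz.
Qed.

(** * From tilings to groups and back *)

Theorem theorem2p2 (n k1 k2 : nat) (hk : (k2 < k1)%N) (hn : (2 <= n)%N) :
  let I := istar (- k2%:Z) k1%:Z in
  let order := (1 + n * (k1 + k2) + 'C(n, 2) * (k1 + k2) ^ 2)%N in
  ((exists C : {pred 'rV[int]_n}, lattice_tiling (@error_ball n 2 k1 k2) C)
   <->
   (exists (gT : finGroupType) (T : {set gT}) (t : 'I_n -> gT),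
      [/\ abelian [set: gT], #|gT| = order,
          T = [set t i | i : 'I_n], #|T| = n
        & group_ring_condition I t \/ partition_condition I T]))
  /\
  (forall (gT : finGroupType) (T : {set gT}) (t : 'I_n -> gT),
     abelian [set: gT] -> #|gT| = order ->
     T = [set t i | i : 'I_n] -> #|T| = n ->
     (group_ring_condition I t <-> partition_condition I T)).
Proof.
move=> I order.
have I0 : 0 \notin I := istar0 _ _.
have uI : uniq I := istar_uniq _ _.
have sizeB : size (ball_seq n I) = order by rewrite size_ball_seq size_istar.
have uB := ball_seq_uniq n uI I0.
have mem_ball x c :
    (x \in translate (@error_ball n 2 k1 k2) c) = (x - c \in ball_seq n I).
  by rewrite mem_ball_seq.
have equiv (gT : finGroupType) (T : {set gT}) (t : 'I_n -> gT) :
    abelian [set: gT] -> #|gT| = order -> T = [set t i | i : 'I_n] -> #|T| = n ->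
  group_ring_condition I t <-> partition_condition I T.
  rewrite -sizeB => abG cardG -> cardT; apply: group_ring_partition => //.
  (* An image of cardinality [n] forces [t] to be injective. *)
  move=> i j; apply: (imset_injP _ : {in 'I_n &, injective t}) => //.
  by rewrite cardT card_ord.
split=> //; split=> [[C [zmodC cov disj]]|[gT [T [t [abG cardG defT cardT cond]]]]].
  have covB x : exists2 a, a \in ball_seq n I & x - a \in C.
    have [c cC] := cov x; rewrite mem_ball => xB.
    by exists (x - c); rewrite ?subKr.
  have injB : {in ball_seq n I &, forall a b, a - b \in C -> a = b}.
    move=> a b aB bB abC; apply/eqP; rewrite -subr_eq0; apply/negPn/negP => ab0.
    (* The vector [a] would lie in the translates by [a - b] and by 0, at the ball elements [b] and
       [a]. *)
    have /negP[] := disj _ _ abC zmodC.1 ab0 a.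
    by rewrite !mem_ball opprB subrKC subr0 aB bB.
  have [gT [r [rD abG cardG uR]]] := finite_quotient uB zmodC covB injB.
  pose t i := r (spike i 1); have rE : r =1 monom t := morph_monom rD.
  have t_inj : injective t.
    (* As [k2 < k1] gives [1 <= k1], the basis vectors are error vectors, and [r] separates them. *)
    have I1 : 1 \in I by rewrite mem_istar /=; lia.
    move=> i j E; have sB x : spike x 1 \in ball_seq n I.
      exact/ball_seqP/BallSpec1.
    have /rowP/(_ i) := uniq_map_inj_in uR (sB i) (sB j) E.
    by rewrite !spikeE eqxx; case: eqP.
  exists gT, [set t i | i : 'I_n], t; split=> //; first by rewrite cardG.
    by rewrite card_imset // card_ord.
  by left; apply/group_ring_condition_uniq; rewrite // -(eq_map rE).
have {cond}gr : group_ring_condition I t.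
  by case: cond => // /(equiv gT T t abG cardG defT cardT).
rewrite -sizeB in cardG.
(* The tiling lattice is the kernel of phi. *)
pose C : {pred 'rV[int]_n} := fun x => monom t x == 1%g.
have CE x : (x \in C) = (monom t x == 1%g) by [].
exists C; split.
- split=> [|x y]; rewrite !CE ?monom0 // monomB // => /eqP-> /eqP->.
  by rewrite invg1 mulg1.
- move=> x.
  have [a aB ax] := (group_ring_condition_cover t abG cardG).1 gr (monom t x).
  exists (x - a); first by rewrite CE monomB // ax mulgV.
  by rewrite mem_ball subKr.
(* Both [x - c] and [x - d] are error vectors with the same image as [x], so injectivity on the ball
   gives [c = d]. *)
move=> c d; rewrite !CE => /eqP c1 /eqP d1 cd x; rewrite !mem_ball.
apply: contra_neqN cd => /andP[xc xd].
have U := (group_ring_condition_uniq t abG cardG).1 gr.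
apply/oppr_inj/(addrI x)/(uniq_map_inj_in U xc xd).
by rewrite !monomB // c1 d1.
Qed.
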